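(* Let $(A,p,0,1)$ be a set $A$ with a ternary operation $p:A\times A\times A\to A$ and two constants $0,1\in A$ satisfying axioms (T1)--(T4). For $\bar a=p(1,a,0)$, $a\cdot b=p(0,a,b)$, $a\circ b=p(a,b,1)$ and $a+b=p(a,b,\bar a)$, the following conditions are equivalent: (i) $(A,+,\cdot,0,1)$ is a Boolean ring; (ii) $(A,\circ,\cdot,\overline{()},0,1)$ is a Boolean algebra; (iii) $p(a,b,c)=(\bar b\cdot a)\circ(b\cdot c)$ for all $a,b,c\in A$; (iv) $p(a,a,b)=a\cdot b$ for all $a,b\in A$; (v) $p(a,b,b)=a\circ b$ for all $a,b\in A$.
   Context: Axioms, for all $a,b,c,b_1,b_2,b_3\in A$: (T1) $p(0,a,1)=a$; (T2) $p(a,0,b)=a=p(b,1,a)$; (T3) $p(a,b,a)=a$; (T4) $p(a,p(b_1,b_2,b_3),c)=p(p(a,b_1,c),b_2,p(a,b_3,c))$. A Boolean ring is a unitary ring (with zero $0$ and unit $1$) in which $x\cdot x=x$ for all $x$. In the Boolean algebra $(A,\circ,\cdot,\overline{()},0,1)$, $\circ$ is the join, $\cdot$ the meet, $\overline{()}$ the complement, $0$ the bottom and $1$ the top. *)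

(* Defs.v *)
From mathcomp Require Import all_boot.
Set Implicit Arguments.
Unset Strict Implicit.
Unset Printing Implicit Defensive.

(* Ring and Boolean algebra are predicates on given operations, because the
   library's pzRingType and ctbDistrLatticeType require a carrier with decidable
   equality and a choice operator. As in those structures, zero = one is not
   excluded. *)

Record is_boolean_ring (A : Type) (add mul : A -> A -> A) (zero one : A) :
    Prop := IsBooleanRing {
  bring_addA : associative add;
  bring_addC : commutative add;
  bring_add0 : left_id zero add;
  bring_addN : forall x, exists y, add y x = zero;
  bring_mulA : associative mul;
  bring_mul1l : left_id one mul;
  bring_mul1r : right_id one mul;
  bring_mulDl : left_distributive mul add;
  bring_mulDr : right_distributive mul add;
  bring_mulxx : forall x, mul x x = x
}.

(* A bounded distributive lattice with complements. The lattice part is given by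
   commutativity, associativity and absorption; idempotence follows. *)
Record is_boolean_algebra (A : Type) (join meet : A -> A -> A) (compl : A -> A)
    (bot top : A) : Prop := IsBooleanAlgebra {
  balg_joinA : associative join;
  balg_joinC : commutative join;
  balg_meetA : associative meet;
  balg_meetC : commutative meet;
  balg_joinKI : forall x y, meet x (join x y) = x;
  balg_meetKU : forall x y, join x (meet x y) = x;
  balg_meetUr : right_distributive meet join;
  balg_joinIr : right_distributive join meet;
  balg_join0 : left_id bot join;
  balg_meet1 : left_id top meet;
  balg_joinC1 : forall x, join x (compl x) = top;
  balg_meetC0 : forall x, meet x (compl x) = bot
}.

Section DerivedOperations.

Variables (A : Type) (p : A -> A -> A -> A) (zero one : A).

Definition tcompl (a : A) : A := p one a zero.
Definition tmul (a b : A) : A := p zero a b.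
Definition tjoin (a b : A) : A := p a b one.
Definition tadd (a b : A) : A := p a b (tcompl a).

End DerivedOperations.

Arguments tcompl {A} p zero one a : rename.
Arguments tmul {A} p zero a b : rename.
Arguments tjoin {A} p one a b : rename.
Arguments tadd {A} p zero one a b : rename.

(* Main.v *)
Require Import Defs.
From mathcomp Require Import all_boot.
Set Implicit Arguments.
Unset Strict Implicit.
Unset Printing Implicit Defensive.

(** Read [p a b c] as: if [b] then [c] else [a].  Axiom (T4) says that every map
    [p a _ c] commutes with branching, and three of its instances drive the whole
    proof: right multiplication, left addition and complementation all pass
    through the two outer arguments of [p],
      [p a b c * d = p (a * d) b (c * d)], [d + p a b c = p (d + a) b (d + c)],
      [~ p a b c = p (~ a) b (~ c)]
    ([tmul_distr], [tadd_distr], [tcompl_distr]).  So [*], [+] and the join are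
    associative in every such algebra, the complement is an involution exchanging
    meet and join, and [p a (~ b) c = p c b a].  What can fail is commutativity,
    idempotence and [~ a * a = 0].

    (i) => (ii): a Boolean ring is commutative of characteristic 2.  Given a
    commutative idempotent product with [~ a * a = 0], absorption is (T3) in
    disguise, and the remaining laws follow by De Morgan duality.

    (ii) => (iii): in a Boolean algebra, elements with the same meets with [c]
    and with [~ c] are equal, and both of these meets of [p a b c] are lattice
    expressions.

    (iii) => (iv): (T3) read through (iii) gives [~ a \/ a = 1], dually
    [~ a * a = 0].

    (iv) <=> (v): these are each other's images under complementation.

    (iv) => (i): (T3) gives [a * a = a] and [a + a = 0], so [+] is an abelian
    group of exponent 2.  Passing translations through [p] yields one distributive
    law, and (iv) yields [a * (a + b) = a + a * b]; expanding the square of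
    [a + b] then makes the product commutative. *)

(** * Idempotent multiplications over groups of exponent two *)

Section ExponentTwo.

Variables (A : Type) (add mul : A -> A -> A) (zero : A).
Hypothesis addA : associative add.
Hypothesis add0x : left_id zero add.
Hypothesis addxx : forall x, add x x = zero.

Lemma exp2_addKl x y : add x (add x y) = y.
Proof. by rewrite addA addxx add0x. Qed.

Lemma exp2_add_inj x y z : add x y = add x z -> y = z.
Proof. by move=> e; rewrite -(exp2_addKl x y) e exp2_addKl. Qed.

Lemma exp2_addx0 : right_id zero add.
Proof. by move=> x; rewrite -(addxx x) exp2_addKl. Qed.

Lemma exp2_add_eq0 x y : add x y = zero -> x = y.
Proof. by move=> e; apply: (@exp2_add_inj x); rewrite e addxx. Qed.

(** [x + y] and [y + x] cancel, by associativity and exponent two alone. *)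
Lemma exp2_addC : commutative add.
Proof.
move=> x y; apply: exp2_add_eq0.
by rewrite -addA (addA y) addxx add0x addxx.
Qed.

Hypothesis mulxx : forall x, mul x x = x.
Hypothesis mulDl : left_distributive mul add.
Hypothesis mulxDx : forall x y, mul x (add x y) = add x (mul x y).

(** The classical argument expands [(x + y) * (x + y) = x + y].  Of the second
    distributive law it uses only the instance [mulxDx], which is what makes it
    apply before that law is known. *)
Lemma exp2_idem_mulC : commutative mul.
Proof.
move=> x y; apply: exp2_add_eq0.
have e : add (add x y) (add (mul x y) (mul y x)) = add x y.
  have yDx : mul y (add x y) = add y (mul y x) by rewrite (exp2_addC x) mulxDx.
  transitivity (mul (add x y) (add x y)); last exact: mulxx.
  by rewrite mulDl mulxDx yDx -!addA; congr add; rewrite !addA (exp2_addC y).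
by apply: (@exp2_add_inj (add x y)); rewrite e exp2_addx0.
Qed.

End ExponentTwo.

Section BooleanRing.

Variables (A : Type) (add mul : A -> A -> A) (zero one : A).
Hypothesis R : is_boolean_ring add mul zero one.

Lemma bring_addxx x : add x x = zero.
Proof.
have idem_eq0 z : add z z = z -> z = zero.
  move=> zz; have [y yz] := bring_addN R z.
  by rewrite -(bring_add0 R z) -{1}yz -(bring_addA R) zz yz.
by apply: idem_eq0; rewrite -{1 2 3 4}(bring_mulxx R x)
  -(bring_mulDl R) -(bring_mulDr R) (bring_mulxx R).
Qed.

Lemma bring_mulC : commutative mul.
Proof.
apply: (exp2_idem_mulC (bring_addA R) (bring_add0 R) bring_addxx
  (bring_mulxx R) (bring_mulDl R)) => x y.
by rewrite (bring_mulDr R) (bring_mulxx R).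
Qed.

End BooleanRing.

(** * Boolean algebras *)

Section BooleanAlgebra.

Variables (A : Type) (join meet : A -> A -> A) (compl : A -> A) (bot top : A).
Hypothesis B : is_boolean_algebra join meet compl bot top.

(** An element is the join of its parts below [c] and below [compl c]. *)
Lemma balg_eq_split c x y :
  meet c x = meet c y -> meet (compl c) x = meet (compl c) y -> x = y.
Proof.
have split z : join (meet c z) (meet (compl c) z) = z.
  rewrite !(balg_meetC B _ z) -(balg_meetUr B) (balg_joinC1 B).
  by rewrite (balg_meetC B) (balg_meet1 B).
by move=> ec enc; rewrite -(split x) ec enc split.
Qed.

Lemma balg_joinCI x y : join x (meet (compl x) y) = join x y.
Proof. by rewrite (balg_joinIr B) (balg_joinC1 B) (balg_meet1 B). Qed.

End BooleanAlgebra.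

(** * Algebras satisfying (T1)-(T4) *)

Section Ternary.

Variables (A : Type) (p : A -> A -> A -> A) (zero one : A).
Hypothesis T1 : forall a, p zero a one = a.
Hypothesis T2 : forall a b, p a zero b = a /\ a = p b one a.
Hypothesis T3 : forall a b, p a b a = a.
Hypothesis T4 : forall a b1 b2 b3 c,
  p a (p b1 b2 b3) c = p (p a b1 c) b2 (p a b3 c).

Local Notation compl := (tcompl p zero one).
Local Notation mul := (tmul p zero).
Local Notation join := (tjoin p one).
Local Notation add := (tadd p zero one).

Lemma tern0 a b : p a zero b = a. Proof. by case: (T2 a b). Qed.

Lemma tern1 a b : p a one b = b. Proof. by case: (T2 b a). Qed.

Lemma tcompl0 : compl zero = one. Proof. exact: tern0. Qed.

Lemma tcompl1 : compl one = zero. Proof. exact: tern1. Qed.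

Lemma tern_compl a b c : p a (compl b) c = p c b a.
Proof. by rewrite /tcompl T4 tern0 tern1. Qed.

Lemma tcomplK : involutive compl.
Proof. by move=> a; rewrite {1}/tcompl tern_compl T1. Qed.

Lemma tcompl_distr a b c : compl (p a b c) = p (compl a) b (compl c).
Proof. exact: T4. Qed.

Lemma tmul_distr a b c d : mul (p a b c) d = p (mul a d) b (mul c d).
Proof. exact: T4. Qed.

Lemma tjoin_distr a b c d : join d (p a b c) = p (join d a) b (join d c).
Proof. exact: T4. Qed.

Lemma tadd_distr a b c d : add d (p a b c) = p (add d a) b (add d c).
Proof. exact: T4. Qed.

Lemma tmul0x a : mul zero a = zero. Proof. exact: tern0. Qed.

Lemma tmulx0 a : mul a zero = zero. Proof. exact: T3. Qed.

Lemma tmul1x a : mul one a = a. Proof. exact: tern1. Qed.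

Lemma tmulx1 a : mul a one = a. Proof. exact: T1. Qed.

Lemma tmulA : associative mul.
Proof. by move=> a b c; rewrite {4}/tmul tmul_distr tmul0x. Qed.

Lemma tjoin0x a : join zero a = a. Proof. exact: T1. Qed.

Lemma tjoinx1 a : join a one = one. Proof. exact: tern1. Qed.

Lemma tjoinA : associative join.
Proof. by move=> a b c; rewrite {2}/tjoin tjoin_distr tjoinx1. Qed.

Lemma tcompl_join a b : compl (join a b) = mul (compl b) (compl a).
Proof. by rewrite /tjoin tcompl_distr tcompl1 -tern_compl. Qed.

Lemma tcompl_mul a b : compl (mul a b) = join (compl b) (compl a).
Proof. by rewrite /tmul tcompl_distr tcompl0 -tern_compl. Qed.

Lemma tadd_compl a b : add a (compl b) = compl (add a b).
Proof. by rewrite /tadd tern_compl tcompl_distr tcomplK. Qed.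

Lemma tadd0x a : add zero a = a.
Proof. by rewrite /tadd tcompl0 T1. Qed.

Lemma taddx0 a : add a zero = a. Proof. exact: tern0. Qed.

Lemma tadd1x a : add one a = compl a.
Proof. by rewrite /tadd tcompl1. Qed.

Lemma taddA : associative add.
Proof.
by move=> a b c; rewrite {2}/tadd tadd_distr tadd_compl.
Qed.

(** ** Boolean algebra laws *)

Section BooleanLaws.

Hypothesis mulC : commutative mul.
Hypothesis mulxx : forall x, mul x x = x.
Hypothesis mulNx : forall x, mul (compl x) x = zero.

Lemma tjoinC : commutative join.
Proof.
by move=> a b; apply: (can_inj tcomplK); rewrite !tcompl_join mulC.
Qed.

(** Right multiplication by [x] turns [join x y] into [p x y x]. *)
Lemma tjoinKI x y : mul x (join x y) = x.
Proof. by rewrite mulC /tjoin tmul_distr mulxx tmul1x T3. Qed.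

Lemma tmulKU x y : join x (mul x y) = x.
Proof.
rewrite -(tcomplK (join _ _)) tcompl_join (tcompl_mul x) mulC.
by rewrite (tjoinC (compl y)) tjoinKI tcomplK.
Qed.

(** Both sides reduce to [p (y * x) z x], the right-hand one by absorption. *)
Lemma tmulUr : right_distributive mul join.
Proof.
move=> x y z; rewrite mulC (mulC x y) (mulC x z).
rewrite {1}/tjoin tmul_distr tmul1x {3}/tmul tjoin_distr.
by rewrite tjoinC tjoin0x (tjoinC _ x) (mulC y x) tmulKU.
Qed.

Lemma tjoinIr : right_distributive join mul.
Proof.
move=> x y z; apply: (can_inj tcomplK).
by rewrite tcompl_join !tcompl_mul !tcompl_join mulC tmulUr !(mulC (compl x)).
Qed.

Lemma tboolean_algebra : is_boolean_algebra join mul compl zero one.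
Proof.
split.
- exact: tjoinA.
- exact: tjoinC.
- exact: tmulA.
- exact: mulC.
- exact: tjoinKI.
- exact: tmulKU.
- exact: tmulUr.
- exact: tjoinIr.
- exact: tjoin0x.
- exact: tmul1x.
- by move=> x; apply: (can_inj tcomplK); rewrite tcompl_join mulNx tcompl1.
- by move=> x; rewrite mulC mulNx.
Qed.

End BooleanLaws.

Lemma boolean_algebra_of_ring :
  is_boolean_ring add mul zero one ->
  is_boolean_algebra join mul compl zero one.
Proof.
move=> R; apply: tboolean_algebra.
- exact: bring_mulC R.
- exact: bring_mulxx R.
- move=> x; rewrite -tadd1x (bring_mulDl R) tmul1x (bring_mulxx R).
  exact: (bring_addxx R).
Qed.

(** Meeting with [compl c] turns the third argument of [p a b c] into [zero], and
    meeting with [c] gives [mul c (join a b)]; so [p a b c] is a lattice expression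
    on both sides of [c]. *)
Lemma tern_of_boolean_algebra :
  is_boolean_algebra join mul compl zero one ->
  forall a b c, p a b c = join (mul (compl b) a) (mul b c).
Proof.
move=> B a b c; have mulC := balg_meetC B; have joinC := balg_joinC B.
have mulxx x : mul x x = x.
  by rewrite -{2}(balg_meetKU B x one) (balg_joinKI B).
apply: (balg_eq_split B (c := c)).
  have -> : mul c (p a b c) = mul c (join a b).
    by rewrite !(mulC c) /tjoin !tmul_distr mulxx tmul1x.
  rewrite (balg_meetUr B _ _ (mul b c)) (mulC b) (tmulA c c) mulxx.
  by rewrite -(balg_meetUr B) (joinC (mul _ _)) (balg_joinCI B) joinC.
have cNc : mul c (compl c) = zero by exact: balg_meetC0 B c.
rewrite (balg_meetUr B).
have -> : mul (compl c) (mul b c) = zero by rewrite mulC -tmulA cNc tmulx0.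
rewrite joinC tjoin0x [LHS]mulC tmul_distr cNc -tern_compl.
by rewrite -/(mul (compl b) _) tmulA mulC.
Qed.

(** Law (T3) for [p one a one] becomes [join (compl a) a = one]. *)
Lemma tern_xx_of_formula :
  (forall a b c, p a b c = join (mul (compl b) a) (mul b c)) ->
  forall a b, p a a b = mul a b.
Proof.
move=> pE a b; have joinNx : join (compl a) a = one.
  by rewrite -[RHS](T3 one a) pE !tmulx1.
have mulNx : mul (compl a) a = zero.
  by rewrite -[X in mul _ X]tcomplK -tcompl_join joinNx tcompl1.
by rewrite pE mulNx tjoin0x.
Qed.

(** ** Complementation exchanges the last two conditions *)

Lemma tern_join_of_mul :
  (forall a b, p a a b = mul a b) -> forall a b, p a b b = join a b.
Proof.
move=> paab a b; apply: (can_inj tcomplK).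
by rewrite tcompl_distr tcompl_join -paab tern_compl.
Qed.

Lemma tern_mul_of_join :
  (forall a b, p a b b = join a b) -> forall a b, p a a b = mul a b.
Proof.
move=> pabb a b; apply: (can_inj tcomplK).
by rewrite tcompl_distr tcompl_mul -pabb tern_compl.
Qed.

(** ** Boolean ring laws *)

Section RingLaws.

Hypothesis paab : forall a b, p a a b = mul a b.

Lemma tmulxx a : mul a a = a. Proof. by rewrite -paab T3. Qed.

Lemma tmulNx a : mul (compl a) a = zero.
Proof. by rewrite /tmul tern_compl paab tmulx0. Qed.

Lemma taddxx a : add a a = zero.
Proof. by rewrite /tadd paab -{1}(tcomplK a) tmulNx. Qed.

Lemma taddC : commutative add. Proof. exact: exp2_addC taddA tadd0x taddxx. Qed.

Lemma taddKl a b : add a (add a b) = b.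
Proof. exact: exp2_addKl taddA tadd0x taddxx a b. Qed.

(** Translating [mul (compl a) c = p c a zero] by [c] gives
    [p zero a c = mul a c]. *)
Lemma tmulNDl a c : mul (compl a) c = add c (mul a c).
Proof.
rewrite -(taddKl c (mul (compl a) c)); congr add.
by rewrite {1}/tmul tern_compl tadd_distr taddxx taddx0.
Qed.

(** [mul (add a b) c = p (a * c) b (~ a * c)], whose translate by [a * c] is
    [p zero b c]. *)
Lemma tmulDl : left_distributive mul add.
Proof.
move=> a b c; rewrite -(taddKl (mul a c) (mul (add a b) c)); congr add.
by rewrite /tadd tmul_distr -/(add _ _) tadd_distr taddxx tmulNDl (taddC c) taddKl.
Qed.

Lemma tmulxDx a b : mul a (add a b) = add a (mul a b).
Proof. by rewrite -(paab a b) tadd_distr taddxx. Qed.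

Lemma tmulC : commutative mul.
Proof. exact: exp2_idem_mulC taddA tadd0x taddxx tmulxx tmulDl tmulxDx. Qed.

Lemma tboolean_ring : is_boolean_ring add mul zero one.
Proof.
split.
- exact: taddA.
- exact: taddC.
- exact: tadd0x.
- by move=> x; exists x; apply: taddxx.
- exact: tmulA.
- exact: tmul1x.
- exact: tmulx1.
- exact: tmulDl.
- by move=> a b c; rewrite !(tmulC a) tmulDl.
- exact: tmulxx.
Qed.

End RingLaws.

End Ternary.

Theorem theorem3p2 (A : Type) (p : A -> A -> A -> A) (zero one : A)
    (T1 : forall a, p zero a one = a)
    (T2 : forall a b, p a zero b = a /\ a = p b one a)
    (T3 : forall a b, p a b a = a)
    (T4 : forall a b1 b2 b3 c,
       p a (p b1 b2 b3) c = p (p a b1 c) b2 (p a b3 c)) :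
  let compl := tcompl p zero one in
  let mul := tmul p zero in
  let join := tjoin p one in
  let add := tadd p zero one in
  [<-> is_boolean_ring add mul zero one;
       is_boolean_algebra join mul compl zero one;
       forall a b c, p a b c = join (mul (compl b) a) (mul b c);
       forall a b, p a a b = mul a b;
       forall a b, p a b b = join a b].
Proof.
move=> compl mul join add; tfae.
- exact: boolean_algebra_of_ring.
- exact: tern_of_boolean_algebra.
- exact: tern_xx_of_formula.
- exact: tern_join_of_mul.
- move=> pabb; apply: tboolean_ring => //.
  exact: tern_mul_of_join pabb.
Qed.
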